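(* Let $f:\mathbb{R}^n\times\mathbb{R}^m\to\mathbb{R}^n$ be continuous, let $\mathbb{Y}\subseteq\mathbb{R}^n\times\mathbb{R}^m$ be a non-empty constraint set, and let $\ell_1,\ell_2:\mathbb{Y}\to\mathbb{R}$ be stage costs. Assume that the system $x(k+1)=f(x(k),u(k))$ is strictly dissipative for $\ell_1$ and $\ell_2$, at equilibria $(x_1^e,u_1^e)$ and $(x_2^e,u_2^e)$ with storage functions $\lambda_1$ and $\lambda_2$, respectively. Suppose that $\ell_1,\ell_2,\lambda_1,\lambda_2$ are twice continuously differentiable. For $\mu\in[0,1]$ let $\ell_\mu=\mu\ell_1+(1-\mu)\ell_2$ and let $(x_\mu^e,u_\mu^e)$ be the optimal equilibrium, i.e. the minimiser of $\ell_\mu(x,u)$ over all $(x,u)\in\mathbb{Y}$ with $x=f(x,u)$. Assume that for each $\mu\in[0,1]$ it holds that $(x_\mu^e,u_\mu^e)\in\operatorname{int}\mathbb{Y}$ and that there exist $m_2(\mu)>m_1(\mu)\ge 0$ such that $$\nabla^2_{(x,u)}\Big(\mu\tilde\ell_1+(1-\mu)\tilde\ell_2\Big)(x_\mu^e,u_\mu^e)\ \ge\ m_2(\mu)I$$ and $$\nabla^2_{(x,u)}\Big(\tilde\lambda_\mu^Tf\Big)(x_\mu^e,u_\mu^e)\ \le\ m_1(\mu)I,$$ where $$\tilde\lambda_\mu=\nu_\mu-\mu\nabla_x\lambda_1(x_\mu^e)-(1-\mu)\nabla_x\lambda_2(x_\mu^e)\in\mathbb{R}^n$$ and $\nu_\mu\in\mathbb{R}^n$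 is the Lagrange multiplier of the optimal equilibrium problem $\min_{(x,u)\in\mathbb{Y}}\ell_\mu(x,u)$ s.t. $x=f(x,u)$. Then, for all $\mu\in[0,1]$, the system is locally strictly dissipative for the cost function $\ell_\mu$ at $(x_\mu^e,u_\mu^e)$ with storage function $$\lambda_\mu(x)=\mu\lambda_1(x)+(1-\mu)\lambda_2(x)+\tilde\lambda_\mu^Tx.$$
   Context: Let $\mathbb{X}:=\{x\in\mathbb{R}^n : \text{there is } u\in\mathbb{R}^m \text{ with } (x,u)\in\mathbb{Y}\}$. An equilibrium is a pair $(x^e,u^e)\in\mathbb{Y}$ with $x^e=f(x^e,u^e)$. $\|\cdot\|$ is an arbitrary norm on $\mathbb{R}^n$. $\mathcal{K}_\infty$ is the set of continuous, strictly increasing, unbounded functions $\alpha:[0,\infty)\to[0,\infty)$ with $\alpha(0)=0$. The system is strictly dissipative for the stage cost $\ell$ at an equilibrium $(x^e,u^e)$ if there exist a storage function $\lambda:\mathbb{X}\to\mathbb{R}$, bounded on bounded subsets of $\mathbb{X}$ and bounded from below on $\mathbb{X}$, and $\alpha\in\mathcal{K}_\infty$ such that for all $(x,u)\in\mathbb{Y}$ with $f(x,u)\in\mathbb{X}$ $$\ell(x,u)-\ell(x^e,u^e)+\lambda(x)-\lambda(f(x,u))\ge\alpha(\|x-x^e\|).$$ The system is locally strictly dissipative for $\ell$ at $(x^e,u^e)$ if there is a neighbourhood $\mathcal{N}$ of $(x^e,u^e)$ such that this definition is satisfied with $\mathbb{Y}$ replaced by $\operatorname{cl}\mathcal{N}$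 (and $\mathbb{X}$ by the corresponding projection of $\operatorname{cl}\mathcal{N}$). The rotated stage costs are $\tilde\ell_i(x,u):=\ell_i(x,u)-\ell_i(x_i^e,u_i^e)+\lambda_i(x)-\lambda_i(f(x,u))$, $i=1,2$. With the Lagrange function $L_\mu(x,u,\nu)=\ell_\mu(x,u)+\nu^T(x-f(x,u))$, the Lagrange multiplier $\nu_\mu$ is a vector satisfying the KKT conditions $\frac{\partial L_\mu}{\partial x}(x_\mu^e,u_\mu^e,\nu_\mu)=0$, $\frac{\partial L_\mu}{\partial u}(x_\mu^e,u_\mu^e,\nu_\mu)=0$, $\frac{\partial L_\mu}{\partial\nu}(x_\mu^e,u_\mu^e,\nu_\mu)=0$. $\nabla_x\lambda$ is the (column) gradient, $\nabla^2_{(x,u)}$ the Hessian with respect to $(x,u)$, $I$ the identity matrix, and inequalities between symmetric matrices are in the positive semidefinite sense. All derivatives (including those of $f$) appearing in the hypotheses are understood to exist. *)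

(* Defs.v *)
From HB Require Import structures.
From mathcomp Require Import all_boot all_order all_algebra.
From mathcomp Require Import all_classical all_reals all_analysis.

Set Implicit Arguments.
Unset Strict Implicit.
Unset Printing Implicit Defensive.

Import Order.TTheory GRing.Theory Num.Theory.
Import numFieldNormedType.Exports.

Local Open Scope classical_set_scope.
Local Open Scope ring_scope.

(* Stage costs and storage functions are only defined on the constraint set
   and on its projection.  They are total functions here, and every hypothesis
   and conclusion below only depends on their values on those sets. *)

Section Calculus.
Variable R : realType.

Definition vdot (n : nat) (a b : 'cV[R]_n) : R := (a^T *m b) 0 0.

Definition is_norm (n : nat) (N : 'cV[R]_n -> R) : Prop :=
  [/\ forall x, 0 <= N x,
      forall x, N x = 0 -> x = 0,
      forall (a : R) x, N (a *: x) = `|a| * N x &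
      forall x y, N (x + y) <= N x + N y].

Definition grad (n : nat) (g : 'cV[R]_n -> R) (x : 'cV[R]_n) : 'cV[R]_n :=
  \col_i 'D_(delta_mx i 0) g x.

Definition basis_xu (n m : nat) (k : 'I_(n + m)) : 'cV[R]_n * 'cV[R]_m :=
  match fintype.split k with
  | inl i => (delta_mx i 0, 0)
  | inr j => (0, delta_mx j 0)
  end.

Definition hess (n m : nat) (g : 'cV[R]_n * 'cV[R]_m -> R)
    (p : 'cV[R]_n * 'cV[R]_m) : 'M[R]_(n + m) :=
  \matrix_(i, j) 'D_(basis_xu i) ('D_(basis_xu j) g) p.

Definition psdmx (k : nat) (M : 'M[R]_k) : Prop :=
  forall v : 'cV[R]_k, 0 <= (v^T *m M *m v) 0 0.

Definition loewner_le (k : nat) (A B : 'M[R]_k) : Prop := psdmx (B - A).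

(* In finite dimension, differentiability at p of all the directional
   derivatives is Frechet differentiability at p of the derivative of g. *)
Definition twice_differentiable (V : normedModType R) (g : V -> R) (p : V) :
    Prop :=
  (\forall q \near p, differentiable g q) /\
  (forall v : V, differentiable ('D_v g) p).

Definition C2_on (V : normedModType R) (A : set V) (g : V -> R) : Prop :=
  forall p, A p -> twice_differentiable g p /\
    (forall v w : V, {for p, continuous ('D_w ('D_v g))}).

Definition comb (T : Type) (mu : R) (g1 g2 : T -> R) : T -> R :=
  fun t => mu * g1 t + (1 - mu) * g2 t.

Definition class_Kinfty (a : R -> R) : Prop :=
  [/\ {within `[0, +oo[, continuous a},
      forall r s : R, 0 <= r -> r < s -> a r < a s,
      forall M : R, exists2 r : R, 0 <= r & M < a r &
      a 0 = 0].

End Calculus.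

Section Dissipativity.
Variables (R : realType) (n m : nat).
Local Notation XU := ('cV[R]_n * 'cV[R]_m)%type.
Implicit Types (Y : set XU) (f : XU -> 'cV[R]_n) (N : 'cV[R]_n -> R).
Implicit Types (l : XU -> R) (lam : 'cV[R]_n -> R) (e : XU).

Definition state_set Y : set 'cV[R]_n := [set x | exists u, Y (x, u)].

Definition is_equilibrium Y f e : Prop := Y e /\ e.1 = f e.

Definition rotated_cost f l e lam : XU -> R :=
  fun p => l p - l e + lam p.1 - lam (f p).

Definition strictly_dissipative Y f N l e lam : Prop :=
  [/\ is_equilibrium Y f e,
      forall B, B `<=` state_set Y -> bounded_set B ->
        [bounded lam x | x in B],
      has_lbound (lam @` state_set Y) &
      exists2 alpha : R -> R, class_Kinfty alpha &
        forall p, Y p -> state_set Y (f p) ->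
          alpha (N (p.1 - e.1)) <= rotated_cost f l e lam p].

(* The inclusion in Y expresses that l is only defined on Y. *)
Definition locally_strictly_dissipative Y f N l e lam : Prop :=
  exists W : set XU, [/\ nbhs e W, closure W `<=` Y &
    strictly_dissipative (closure W) f N l e lam].

Definition optimal_equilibrium Y f l e : Prop :=
  is_equilibrium Y f e /\ forall q, is_equilibrium Y f q -> l e <= l q.

Definition lagrangian f l (p : XU) (nu : 'cV[R]_n) : R :=
  l p + vdot nu (p.1 - f p).

Definition lagrange_multiplier f l e (nu : 'cV[R]_n) : Prop :=
  [/\ grad (fun x => lagrangian f l (x, e.2) nu) e.1 = 0,
      grad (fun u => lagrangian f l (e.1, u) nu) e.2 = 0 &
      grad (fun v => lagrangian f l e v) nu = 0].

Definition lambda_tilde (mu : R) (lam1 lam2 : 'cV[R]_n -> R)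
    (x nu : 'cV[R]_n) : 'cV[R]_n :=
  nu - mu *: grad lam1 x - (1 - mu) *: grad lam2 x.

End Dissipativity.

(* Main.v *)
Require Import Defs.
From HB Require Import structures.
From mathcomp Require Import all_boot all_order all_algebra.
From mathcomp Require Import all_classical all_reals all_analysis.
From mathcomp Require Import ring lra.

(** Write [a] for the correction vector [lambda_tilde], [r] for the convex
    combination of the two rotated costs and [g p := a . f p].  Adding the
    linear term [a . x] to the storage function turns the rotated cost of the
    combined stage cost, at the equilibrium [e], into
      [F p = (r p - r e) + a . (p.1 - e.1) - (g p - g e)],
    so that [F e = 0].  Strict dissipativity near [e] is a lower bound of [F]
    by a class-K-infinity function of the distance to [e], and it holds because
    [F] has a nondegenerate local minimum at [e]:

    - The first derivative of [F] at [e] vanishes.  By the chain rule and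
      [f e = e.1], the storage functions contribute the gradient of their
      combination paired with [h.1 - df h], and [a] is the multiplier minus that
      gradient; what remains is the derivative of the Lagrangian, which is zero
      by the KKT conditions ([stationarity]).

    - The second derivative of [F] at [e] is the one of [r] minus the one of
      [g], the linear term having none, hence it is at least [m2 - m1 > 0]
      times the square of the Euclidean norm.  Taylor's formula with Peano
      remainder ([taylor_young2]), applied to [r] and to [g], then bounds [F]
      below by [(m2 - m1) / 4] times the square of the norm near [e]
      ([quadratic_growth]).

    On a small closed ball around [e] inside the constraint set, this quadratic
    lower bound gives dissipativity with a quadratic comparison function, for
    any norm since every norm is dominated by the sup norm, and the storage
    function is bounded there ([dissipative_of_quadratic_growth]). *)

Set Implicit Arguments.
Unset Strict Implicit.
Unset Printing Implicit Defensive.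

Import Order.TTheory GRing.Theory Num.Theory.
Import numFieldNormedType.Exports.

Local Open Scope classical_set_scope.
Local Open Scope ring_scope.

(** * Directional derivatives *)

(** Only the restriction of [g] to the line through [a x] in direction [w]
    matters.  This covers the restriction of a function to a line as well as
    partial derivatives and precomposition with a projection. *)
Lemma is_derive_affine (R : realType) (U V W : normedModType R) (a : U -> V)
    (g : V -> W) (x v : U) (w : V) :
  (forall s : R, a (s *: v + x) = s *: w + a x) -> derivable g (a x) w ->
  is_derive x v (fun y => g (a y)) ('D_w g (a x)).
Proof.
move=> aP dg.
have E : (fun s : R => s^-1 *: (((fun y => g (a y)) \o shift x) (s *: v)
      - g (a x))) =
    (fun s => s^-1 *: ((g \o shift (a x)) (s *: w) - g (a x))).
  by apply/funext => s /=; rewrite aP.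
by apply: DeriveDef; rewrite /derivable /derive E.
Qed.

Lemma is_derive_line (R : realType) (V : normedModType R) (g : V -> R)
    (p h : V) (t : R) :
  differentiable g (t *: h + p) ->
  is_derive t 1 (fun s => g (s *: h + p)) ('D_h g (t *: h + p)).
Proof.
move=> dg; have aff (s : R) : (s *: 1 + t) *: h + p = s *: h + (t *: h + p).
  by rewrite [s *: 1]mulr1 scalerDl addrA.
apply: (@is_derive_affine R R V R (fun s => s *: h + p)) => //.
exact: diff_derivable.
Qed.

Lemma is_derive_comp (R : realType) (U V W : normedModType R) (f : U -> V)
    (g : V -> W) (p h : U) :
  differentiable f p -> differentiable g (f p) ->
  is_derive p h (g \o f) ('d g (f p) ('d f p h)).
Proof.
move=> df dg; have dgf := differentiable_comp df dg.
by apply: DeriveDef; [exact: diff_derivable|rewrite deriveE// diff_comp].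
Qed.

Lemma derive_linear (R : realType) (V : normedModType R) (k : nat)
    (b : 'I_k -> V) (c : 'I_k -> R) (g : V -> R) (q : V) :
  differentiable g q ->
  'D_(\sum_i c i *: b i) g q = \sum_i c i * 'D_(b i) g q.
Proof.
move=> dg; rewrite deriveE// raddf_sum; apply: eq_bigr => i _.
by rewrite /= linearZ /= deriveE.
Qed.

(** The expansion of the inner derivative is valid in a whole neighbourhood
    of [p], which is why it may be differentiated once more. *)
Lemma derive2_linear (R : realType) (V : normedModType R) (k : nat)
    (b : 'I_k -> V) (c : 'I_k -> R) (g : V -> R) (p w : V) :
  twice_differentiable g p ->
  'D_w ('D_(\sum_i c i *: b i) g) p =
  \sum_i c i * 'D_w ('D_(b i) g) p.
Proof.
move=> [ndg d2g].
have E : \forall q \near p, 'D_(\sum_i c i *: b i) g q =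
    (\sum_i c i *: 'D_(b i) g) q.
  apply: filterS ndg => q dg; rewrite derive_linear// fct_sumE.
  by apply: eq_bigr.
have db i : derivable ('D_(b i) g) p w by apply: diff_derivable.
rewrite (near_eq_derive _ E) derive_sum; last by move=> i; apply: derivableZ.
by apply: eq_bigr => i _; rewrite deriveZ.
Qed.

(** * Second-order Taylor formula *)

Lemma diff_near (R : realType) (V : normedModType R) (g : V -> R) (p : V)
    (eps : R) :
  differentiable g p -> 0 < eps ->
  \forall h \near (0 : V), `|g (h + p) - g p - 'd g p h| <= eps * `|h|.
Proof.
move=> dg eps0.
have /eqaddoP /(_ eps eps0) := diff_locally dg.
by apply: filterS => h; rewrite /= !fctE /= opprD addrA.
Qed.

(** The finite family [b] with bounded coordinates [c] makes the remainder
    uniform in the direction of [h]: only the finitely many derivatives along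
    the [b i] have to be linearised at [p].  Along the segment from [p] to
    [h + p] the derivative of the remainder is a combination of the errors of
    these linearisations, and the mean value theorem concludes. *)
Lemma taylor_young2 (R : realType) (V : normedModType R) (k : nat)
    (b : 'I_k -> V) (c : 'I_k -> V -> R) (g : V -> R) (p : V) (eps : R) :
  (forall h, h = \sum_i c i h *: b i) ->
  (forall i h, `|c i h| <= `|h|) ->
  twice_differentiable g p -> 0 < eps ->
  \forall h \near (0 : V),
    `|g (h + p) - (g p + 'D_h g p + 2^-1 * 'D_h ('D_h g) p)|
      <= eps * `|h| ^+ 2.
Proof.
move=> hb hc d2 eps0; have [ndg d2g] := d2.
(* The [k] linearisation errors add up; [k.+1] rather than [k] since the family
   may be empty. *)
pose eta := eps / k.+1%:R.
have eta0 : 0 < eta by rewrite divr_gt0.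
have N1 : \forall h \near (0 : V), forall i,
    `|'D_(b i) g (h + p) - 'D_(b i) g p - 'd ('D_(b i) g) p h| <= eta * `|h|.
  by apply: filter_forall => i; apply: diff_near.
have N2 : \forall h \near (0 : V), differentiable g (h + p).
  by move: ndg; rewrite (near_shift 0 p) /= subr0.
have [r /= r0 Hr] := iffLR nbhs_norm0P (filterI N1 N2).
apply/nbhs_norm0P; exists r => // h /= hr.
have small (t : R) : 0 <= t <= 1 -> `|t *: h| < r.
  move=> /andP[t0 t1]; rewrite normrZ ger0_norm//.
  by apply: le_lt_trans hr; rewrite ler_piMl.
have near_p (t : R) : 0 <= t <= 1 -> (forall i,
    `|'D_(b i) g (t *: h + p) - 'D_(b i) g p - 'd ('D_(b i) g) p (t *: h)|
      <= eta * `|t *: h|) /\ differentiable g (t *: h + p).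
  by move=> t01; apply: Hr; apply: small.
have dgp : differentiable g p by apply: nbhs_singleton ndg.
pose H : R := 'D_h ('D_h g) p.
pose phi (t : R) := g (t *: h + p) - (t * 'D_h g p + 2^-1 * t ^+ 2 * H).
pose dphi (t : R) : R := 'D_h g (t *: h + p) - ('D_h g p + t * H).
have dphiP (t : R) : 0 <= t <= 1 -> is_derive t 1 phi (dphi t).
  move=> /near_p[_ dgt]; have := is_derive_line dgt => D1.
  have D2 : is_derive t 1 (fun t : R => t * 'D_h g p + 2^-1 * t ^+ 2 * H)
      ('D_h g p + t * H).
    by apply: is_derive_eq; rewrite /GRing.scale /=; field.
  exact: (is_deriveB D1 D2).
have [t t01] : exists2 t, t \in `]0, 1[%R & phi 1 - phi 0 = dphi t * (1 - 0).
  apply: MVT => //.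
    move=> t; rewrite in_itv /= => /andP[/ltW t0 /ltW t1].
    by apply: dphiP; rewrite t0.
  apply: derivable_within_continuous => t; rewrite in_itv /= => t01.
  by have [] := dphiP t t01.
have t01' : 0 <= t <= 1.
  by move: t01; rewrite in_itv /= => /andP[/ltW -> /ltW ->].
have -> : phi 1 - phi 0 = g (h + p) - (g p + 'D_h g p + 2^-1 * H).
  rewrite /phi scale1r scale0r add0r; ring.
rewrite subr0 mulr1 => ->.
have [near_t dgt] := near_p t t01'.
have -> : dphi t = \sum_i c i h * ('D_(b i) g (t *: h + p) - 'D_(b i) g p -
    'd ('D_(b i) g) p (t *: h)).
  have L q : differentiable g q -> 'D_h g q = \sum_i c i h * 'D_(b i) g q.
    by move=> dg; rewrite {1}(hb h) derive_linear.
  have -> : dphi t = 'D_h g (t *: h + p) - ('D_h g p + t * H) by [].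
  have -> : H = \sum_i c i h * 'D_h ('D_(b i) g) p.
    by rewrite /H {1}(hb h) derive2_linear.
  rewrite !L// mulr_sumr opprD addrA -!sumrB; apply: eq_bigr => i _.
  have -> : 'd ('D_(b i) g) p (t *: h) = t * 'D_h ('D_(b i) g) p.
    by rewrite linearZ deriveE.
  ring.
apply: le_trans (ler_norm_sum _ _ _) _.
apply: (@le_trans _ _ (\sum_(i < k) eta * `|h| ^+ 2)).
  apply: ler_sum => i _; rewrite normrM expr2 mulrCA.
  apply: ler_pM => //; apply: le_trans (near_t i) _.
  rewrite ler_wpM2l ?(ltW eta0)// normrZ.
  by case/andP: t01' => t0 t1; rewrite ger0_norm// ler_piMl.
rewrite sumr_const card_ord -mulr_natl mulrA ler_wpM2r ?sqr_ge0//.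
by rewrite /eta mulrC -mulrA ger_pMr// mulrC ler_pdivrMr// mul1r ler_nat.
Qed.

(** * Coordinates on pairs of vectors *)

Lemma mx_entry_le_norm (R : realType) (n m : nat) (M : 'M[R]_(n, m)) i j :
  `|M i j| <= `|M|.
Proof.
rewrite -[leRHS]/(mx_norm M) mx_normrE.
exact: (le_bigmax _ (fun ij => `|M ij.1 ij.2|) (i, j)).
Qed.

Lemma mx_norm_sqr_le (R : realType) (n m : nat) (M : 'M[R]_(n, m)) (s : R) :
  0 <= s -> (forall i j, `|M i j| ^+ 2 <= s) -> `|M| ^+ 2 <= s.
Proof.
move=> s0 Ms; have [/eqP M0|M0] := boolP (mx_norm M == 0).
  by rewrite -[`|M|]/(mx_norm M) M0 expr0n.
by have [ij Eij] := mx_norm_neq0 M0; rewrite -[`|M|]/(mx_norm M) Eij; apply: Ms.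
Qed.

Lemma xu_frame (R : realType) (n m : nat) (h : 'cV[R]_n * 'cV[R]_m) :
  h = \sum_k col_mx h.1 h.2 k 0 *: basis_xu R k.
Proof.
case: h => x u /=; rewrite big_split_ord /=.
have -> : \sum_i col_mx x u (lshift m i) 0 *: basis_xu R (lshift m i) =
    \sum_i x i 0 *: (delta_mx i 0, 0 : 'cV[R]_m).
  by apply: eq_bigr => i _; rewrite col_mxEu /basis_xu (unsplitK (inl _ i)).
have -> : \sum_j col_mx x u (rshift n j) 0 *: basis_xu R (rshift n j) =
    \sum_j u j 0 *: (0 : 'cV[R]_n, delta_mx j 0).
  by apply: eq_bigr => j _; rewrite col_mxEd /basis_xu (unsplitK (inr _ j)).
have E1 (k : nat) (y : 'cV[R]_k) : y = \sum_i y i 0 *: delta_mx i 0.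
  by rewrite {1}[y]matrix_sum_delta; apply: eq_bigr => i _; rewrite big_ord1.
rewrite [LHS]surjective_pairing [RHS]surjective_pairing /=; congr pair.
  rewrite (raddf_sum fst) (raddf_sum fst) /= [X in _ + X]big1 ?addr0 -?E1//.
  by move=> i _; rewrite scaler0.
rewrite (raddf_sum snd) (raddf_sum snd) /= big1 ?add0r -?E1//.
by move=> i _; rewrite scaler0.
Qed.

Lemma xu_coord_le_norm (R : realType) (n m : nat) (h : 'cV[R]_n * 'cV[R]_m) k :
  `|col_mx h.1 h.2 k 0| <= `|h|.
Proof.
rewrite prod_normE le_max; case: (fintype.splitP k) => j Ej.
  by rewrite (_ : k = lshift m j) ?col_mxEu ?mx_entry_le_norm//; apply/val_inj.
rewrite (_ : k = rshift n j) ?col_mxEd ?mx_entry_le_norm ?orbT//.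
exact/val_inj.
Qed.

(** The norm of a pair is the largest absolute value of an entry, so it is
    dominated by the Euclidean norm, in which the Loewner order is expressed. *)
Lemma xu_norm_sqr_le (R : realType) (n m : nat) (h : 'cV[R]_n * 'cV[R]_m) :
  `|h| ^+ 2 <= ((col_mx h.1 h.2)^T *m col_mx h.1 h.2) 0 0.
Proof.
set v := col_mx _ _.
have E : (v^T *m v) 0 0 = \sum_k v k 0 ^+ 2.
  by rewrite mxE; apply: eq_bigr => k _; rewrite mxE expr2.
have s0 : 0 <= (v^T *m v) 0 0 by rewrite E sumr_ge0// => k _; rewrite sqr_ge0.
have le_k k : `|v k 0| ^+ 2 <= (v^T *m v) 0 0.
  rewrite E (bigD1 k)//= real_normK ?num_real// lerDl sumr_ge0// => i _.
  by rewrite sqr_ge0.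
rewrite prod_normE; have [_|_] := leP `|h.1| `|h.2|;
  apply: mx_norm_sqr_le => //.
  by move=> i j; rewrite ord1; have := le_k (rshift n i); rewrite /v col_mxEd.
by move=> i j; rewrite ord1; have := le_k (lshift m i); rewrite /v col_mxEu.
Qed.

Lemma derive2_hess (R : realType) (n m : nat)
    (g : 'cV[R]_n * 'cV[R]_m -> R) (p h : 'cV[R]_n * 'cV[R]_m) :
  twice_differentiable g p ->
  'D_h ('D_h g) p =
  ((col_mx h.1 h.2)^T *m hess g p *m col_mx h.1 h.2) 0 0.
Proof.
move=> d2; set v := col_mx _ _.
rewrite {1}(xu_frame h) derive2_linear// [RHS]mxE; apply: eq_bigr => j _.
rewrite mulrC; congr (_ * _).
rewrite {1}(xu_frame h) derive_linear; last exact: d2.2.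
by rewrite mxE; apply: eq_bigr => i _; rewrite [v^T _ _]mxE [hess _ _ _ _]mxE.
Qed.

Lemma loewner_le_hess (R : realType) (n m : nat)
    (g : 'cV[R]_n * 'cV[R]_m -> R) (p h : 'cV[R]_n * 'cV[R]_m) (c : R) :
  twice_differentiable g p ->
  (loewner_le c%:M (hess g p) ->
    c * ((col_mx h.1 h.2)^T *m col_mx h.1 h.2) 0 0 <= 'D_h ('D_h g) p) /\
  (loewner_le (hess g p) c%:M ->
    'D_h ('D_h g) p <= c * ((col_mx h.1 h.2)^T *m col_mx h.1 h.2) 0 0).
Proof.
move=> d2; rewrite derive2_hess//; set v := col_mx _ _.
have E : (v^T *m c%:M *m v) 0 0 = c * (v^T *m v) 0 0.
  by rewrite mul_mx_scalar -scalemxAl mxE.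
have sub (A B : 'M[R]_(n + m)) :
    (v^T *m (B - A) *m v) 0 0 = (v^T *m B *m v) 0 0 - (v^T *m A *m v) 0 0.
  by rewrite mulmxBr mulmxBl [LHS]mxE; congr (_ + _); rewrite mxE.
by split=> /(_ v); rewrite sub E subr_ge0.
Qed.

(** * Gradients and the scalar product *)

Lemma vdotE (R : realType) (n : nat) (a b : 'cV[R]_n) :
  vdot a b = \sum_i a i 0 * b i 0.
Proof. by rewrite /vdot mxE; apply: eq_bigr => i _; rewrite mxE. Qed.

Lemma vdot_is_linear (R : realType) (n : nat) (a : 'cV[R]_n) :
  linear (vdot a).
Proof.
by move=> k x y; rewrite /vdot mulmxDr -scalemxAr !mxE.
Qed.

HB.instance Definition _ (R : realType) (n : nat) (a : 'cV[R]_n) :=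
  GRing.isLinear.Build R 'cV[R]_n R _ (vdot a) (vdot_is_linear a).

Lemma vdot_continuous (R : realType) (n : nat) (a : 'cV[R]_n) :
  continuous (vdot a).
Proof.
have -> : vdot a = (fun x => \sum_i a i 0 * x i 0).
  by apply/funext => x; rewrite vdotE.
apply: (@continuous_big R _ +%R 0 xpredT (@add_continuous R)) => i _ x.
apply: (@continuous_comp _ _ _ (fun x : 'cV[R]_n => x i 0) ( *%R (a i 0))).
  exact: coord_continuous.
exact: mulrl_continuous.
Qed.

Lemma differentiable_vdot (R : realType) (n : nat) (a x : 'cV[R]_n) :
  differentiable (vdot a) x.
Proof. exact/linear_differentiable/vdot_continuous. Qed.

Lemma diff_vdot (R : realType) (n : nat) (a x v : 'cV[R]_n) :
  'd (vdot a) x v = vdot a v.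
Proof. by rewrite (@diff_lin _ _ _ (vdot a))//; apply: vdot_continuous. Qed.

Lemma diff_grad (R : realType) (n : nat) (g : 'cV[R]_n -> R) (x v : 'cV[R]_n) :
  differentiable g x -> 'd g x v = vdot (grad g x) v.
Proof.
move=> dg; rewrite -deriveE// {1}[v]matrix_sum_delta.
under eq_bigr do rewrite big_ord1.
rewrite derive_linear// vdotE; apply: eq_bigr => i _.
by rewrite mxE mulrC.
Qed.

(** The KKT conditions speak of the partial gradients in [x] and in [u]
    separately; for a differentiable function they control every direction. *)
Lemma grad_partials_eq0 (R : realType) (n m : nat)
    (g : 'cV[R]_n * 'cV[R]_m -> R) (p h : 'cV[R]_n * 'cV[R]_m) :
  differentiable g p ->
  grad (fun x => g (x, p.2)) p.1 = 0 -> grad (fun u => g (p.1, u)) p.2 = 0 ->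
  'D_h g p = 0.
Proof.
move=> dg g1 g2; rewrite (xu_frame h) derive_linear// big1// => k _.
apply/eqP; rewrite mulf_eq0; apply/orP; right; apply/eqP.
case: p dg g1 g2 => x u /= dg g1 g2; rewrite /basis_xu.
case: (fintype.split k) => i.
  move/colP: g1 => /(_ i); rewrite !mxE => <-; symmetry.
  apply: derive_val; apply: (is_derive_affine (a := fun y => (y, u))) => [s|].
    by congr pair; rewrite /= scaler0 add0r.
  exact: diff_derivable.
move/colP: g2 => /(_ i); rewrite !mxE => <-; symmetry.
apply: derive_val; apply: (is_derive_affine (a := fun y => (x, y))) => [s|].
  by congr pair; rewrite /= scaler0 add0r.
exact: diff_derivable.
Qed.

Lemma differentiable_comb (R : realType) (V : normedModType R) (mu : R)
    (g1 g2 : V -> R) (x : V) :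
  differentiable g1 x -> differentiable g2 x ->
  differentiable (comb mu g1 g2) x.
Proof.
move=> d1 d2.
exact: differentiableD (differentiableZ _ d1) (differentiableZ _ d2).
Qed.

Lemma grad_comb (R : realType) (n : nat) (mu : R) (g1 g2 : 'cV[R]_n -> R)
    (x : 'cV[R]_n) :
  differentiable g1 x -> differentiable g2 x ->
  grad (comb mu g1 g2) x = mu *: grad g1 x + (1 - mu) *: grad g2 x.
Proof.
move=> d1 d2; apply/colP => i; rewrite !mxE.
have D (g : 'cV[R]_n -> R) : differentiable g x -> derivable g x (delta_mx i 0).
  exact: diff_derivable.
rewrite deriveD; [|exact: derivableZ (D _ d1)|exact: derivableZ (D _ d2)].
by rewrite !deriveZ//; exact: D.
Qed.

(** * Growth of the rotated cost around the equilibrium *)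

(** The choice of the linear correction of the storage function: replacing
    the multiplier [nu] by [nu - grad lam e.1] compensates the derivative of
    [lam p.1 - lam (f p)], and the sum is the derivative of the Lagrangian.  The
    equation [e.1 = f e] is what lets both terms use the same gradient of
    [lam]. *)
Lemma stationarity (R : realType) (n m : nat)
    (f : 'cV[R]_n * 'cV[R]_m -> 'cV[R]_n) (l : 'cV[R]_n * 'cV[R]_m -> R)
    (lam : 'cV[R]_n -> R) (e h : 'cV[R]_n * 'cV[R]_m) (nu : 'cV[R]_n) :
  e.1 = f e -> differentiable f e -> differentiable l e ->
  differentiable lam e.1 -> lagrange_multiplier f l e nu ->
  let a := nu - grad lam e.1 in
  'D_h (rotated_cost f l e lam) e + vdot a h.1
    - 'D_h (fun p => vdot a (f p)) e = 0.
Proof.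
move=> ee df dl dlam [kx ku _] a.
have dl_h : is_derive e h l ('D_h l e) := derivableP (diff_derivable dl).
have dvf b : is_derive e h (fun p => vdot b (f p)) (vdot b ('d f e h)).
  have := is_derive_comp h df (differentiable_vdot b (f e)).
  by rewrite diff_vdot.
have dlam1 : is_derive e h (fun p => lam p.1) (vdot (grad lam e.1) h.1).
  rewrite -diff_grad// -deriveE//.
  by apply: (is_derive_affine (a := fst)) => //; apply: diff_derivable.
have dv1 b : is_derive e h (fun p => vdot b p.1) (vdot b h.1).
  rewrite -[X in is_derive _ _ _ X](diff_vdot b e.1 h.1) -deriveE;
    last exact: differentiable_vdot.
  apply: (is_derive_affine (a := fst)) => //.
  exact/diff_derivable/differentiable_vdot.
have dlamf : is_derive e h (fun p => lam (f p))
    (vdot (grad lam e.1) ('d f e h)).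
  have dlamf : differentiable lam (f e) by rewrite -ee.
  by have := is_derive_comp h df dlamf; rewrite diff_grad// -ee.
have drot : is_derive e h (rotated_cost f l e lam)
    ('D_h l e - 0 + vdot (grad lam e.1) h.1 - vdot (grad lam e.1) ('d f e h)).
  exact: is_deriveB (is_deriveD (is_deriveB dl_h (is_derive_cst _ _ _)) dlam1)
    dlamf.
have dLagE : (fun p => lagrangian f l p nu) =
    (fun p => l p + (vdot nu p.1 - vdot nu (f p))).
  by apply/funext => p; rewrite /lagrangian linearB.
have dLag : is_derive e h (fun p => lagrangian f l p nu)
    ('D_h l e + (vdot nu h.1 - vdot nu ('d f e h))).
  rewrite dLagE; exact: is_deriveD dl_h (is_deriveB (dv1 nu) (dvf nu)).
have dLagd : differentiable (fun p => lagrangian f l p nu) e.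
  rewrite dLagE; apply: differentiableD => //; apply: differentiableB.
    apply: (@differentiable_comp _ _ _ _ fst (vdot nu));
      last exact: differentiable_vdot.
    by apply: linear_differentiable => x; exact: cvg_fst.
  exact: (differentiable_comp df (differentiable_vdot nu (f e))).
have := grad_partials_eq0 h dLagd kx ku.
rewrite (derive_val (is_derive := dLag)) (derive_val (is_derive := drot)).
rewrite (derive_val (is_derive := dvf a)) => E.
have aE x : vdot a x = vdot nu x - vdot (grad lam e.1) x.
  by rewrite !vdotE -sumrB; apply: eq_bigr => i _; rewrite !mxE mulrBl.
by rewrite !aE; lra.
Qed.

Lemma quadratic_growth (R : realType) (n m : nat)
    (r g : 'cV[R]_n * 'cV[R]_m -> R) (e : 'cV[R]_n * 'cV[R]_m)
    (a : 'cV[R]_n) (m1 m2 : R) :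
  twice_differentiable r e -> twice_differentiable g e -> m1 < m2 ->
  loewner_le m2%:M (hess r e) -> loewner_le (hess g e) m1%:M ->
  (forall h, 'D_h r e + vdot a h.1 - 'D_h g e = 0) ->
  \forall h \near (0 : 'cV[R]_n * 'cV[R]_m), (m2 - m1) / 4 * `|h| ^+ 2 <=
    (r (h + e) - r e) + vdot a h.1 - (g (h + e) - g e).
Proof.
move=> r2 g2 m12 Hr Hg st.
(* The second-order terms contribute [(m2 - m1) / 2]; two remainders of size
   [(m2 - m1) / 8] leave half of it. *)
have eps0 : 0 < (m2 - m1) / 8 by rewrite divr_gt0// subr_gt0.
have tay k := taylor_young2 (@xu_frame R n m)
  (fun i h => xu_coord_le_norm h i) k eps0.
have Tr := tay _ _ r2; have Tg := tay _ _ g2.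
apply: filterS2 Tr Tg => h Tr Tg.
have {}Hr := (loewner_le_hess h m2 r2).1 Hr.
have {}Hg := (loewner_le_hess h m1 g2).2 Hg.
have {st} := st h; have := xu_norm_sqr_le h.
move: Hr Hg; set s := (_ *m _) 0 0 => Hr Hg qs st.
move: Tr Tg => /ler_normlP[Tr _] /ler_normlP[_ Tg].
move: Tr Tg qs; set q := `|h| ^+ 2 => Tr Tg qs.
have : (m2 - m1) * q <= (m2 - m1) * s by rewrite ler_pM2l// subr_gt0.
lra.
Qed.

(** * From quadratic growth to local strict dissipativity *)

Lemma norm_le_sup (R : realType) (n : nat) (N : 'cV[R]_n -> R) :
  is_norm N -> exists2 K, 0 < K & forall x, N x <= K * `|x|.
Proof.
move=> [N0 _ NZ ND].
(* The [1] keeps the constant positive when [n = 0]. *)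
exists (1 + \sum_(i < n) N (delta_mx i 0)) => [|x].
  by rewrite ltr_pwDl// sumr_ge0.
have Nsum (s : seq 'I_n) (F : 'I_n -> 'cV[R]_n) :
    N (\sum_(i <- s) F i) <= \sum_(i <- s) N (F i).
  elim: s => [|i s IH]; first by rewrite !big_nil -(scale0r 0) NZ normr0 mul0r.
  by rewrite !big_cons; apply: le_trans (ND _ _) _; rewrite lerD2l.
rewrite {1}[x]matrix_sum_delta; apply: le_trans (Nsum _ _) _.
rewrite mulrDl mul1r ler_wpDl// mulr_suml; apply: ler_sum => i _.
by rewrite big_ord1 NZ mulrC ler_wpM2l// mx_entry_le_norm.
Qed.

Lemma class_Kinfty_sqr (R : realType) (c : R) :
  0 < c -> class_Kinfty (fun r : R => c * r ^+ 2).
Proof.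
move=> c0; split.
- apply: continuous_subspaceT => x; apply: cvgM; first exact: cvg_cst.
  exact: exprn_continuous.
- move=> r s r0 rs; rewrite ltr_pM2l// ltr_pXn2r// ?nnegrE//.
  exact: le_trans r0 (ltW rs).
- move=> M; exists (1 + `|M| / c); first by rewrite addr_ge0// divr_ge0// ltW.
  have M0 : 0 <= `|M| / c by rewrite divr_ge0// ltW.
  apply: (@lt_le_trans _ _ (c * (1 + `|M| / c))).
    by rewrite mulrDr mulr1 mulrCA mulfV ?gt_eqF// mulr1 ltr_pwDl// ler_norm.
  by rewrite ler_pM2l// expr2 ler_peMl ?lerDl// addr_ge0.
- by rewrite expr0n mulr0.
Qed.

Lemma bounded_on_exP (R : realType) (T : Type) (V : normedModType R)
    (F : T -> V) (A : set T) :
  [bounded F x | x in A] <-> exists M, forall x, A x -> `|F x| <= M.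
Proof.
split=> [/pinfty_ex_gt0[M _ HM]|[M HM]]; first by exists M.
exists M; split; first exact: num_real.
by move=> M' /ltW MM' x /HM /le_trans; apply.
Qed.

(** On a bounded neighbourhood, boundedness of the storage function on bounded
    sets also provides the lower bound that strict dissipativity asks for. *)
Lemma dissipative_of_quadratic_growth (R : realType) (n m : nat)
    (N : 'cV[R]_n -> R) (f : 'cV[R]_n * 'cV[R]_m -> 'cV[R]_n)
    (Y : set ('cV[R]_n * 'cV[R]_m)) (l : 'cV[R]_n * 'cV[R]_m -> R)
    (lam : 'cV[R]_n -> R) (e : 'cV[R]_n * 'cV[R]_m) (c : R) :
  is_norm N -> interior Y e -> e.1 = f e ->
  (forall B, B `<=` state_set Y -> bounded_set B -> [bounded lam x | x in B]) ->
  0 < c ->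
  (\forall h \near (0 : 'cV[R]_n * 'cV[R]_m),
    c * `|h| ^+ 2 <= rotated_cost f l e lam (h + e)) ->
  locally_strictly_dissipative Y f N l e lam.
Proof.
move=> normN Ye ee blam c0 growth.
have [K K0 NK] := norm_le_sup normN.
have Ye' : \forall h \near (0 : 'cV[R]_n * 'cV[R]_m), Y (h + e).
  have : \forall p \near e, Y p by [].
  by rewrite (near_shift 0 e) /= subr0.
have [r /= r0 Hr] := iffLR nbhs_norm0P (filterI growth Ye').
(* Half the radius, so that the closed ball stays in the open ball. *)
pose W := closed_ball e (r / 2).
have r20 : 0 < r / 2 by rewrite divr_gt0.
have clW : closure W = W by apply/esym/closure_id/closed_ball_closed.
have WP p : W p -> `|p - e| <= r / 2.
  by rewrite /W closed_ballE// /closed_ball_ /= distrC.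
have inW p : W p -> c * `|p - e| ^+ 2 <= rotated_cost f l e lam p /\ Y p.
  move=> /WP pe; have := Hr (p - e); rewrite /= subrK; apply.
  by apply: le_lt_trans pe _; lra.
have sub : state_set W `<=` state_set Y.
  by move=> x [u Wxu]; exists u; apply: (inW _ Wxu).2.
have bW : bounded_set (state_set W).
  apply/bounded_on_exP; exists (`|e.1| + r / 2) => x [u /WP].
  rewrite prod_normE ge_max => /andP[xe _].
  by rewrite -[x](subrK e.1) addrC (le_trans (ler_normD _ _))// lerD2l.
exists W; split.
- by apply/nbhs_ballP; exists (r / 2) => //; exact: subset_closed_ball.
- by rewrite clW => p /inW[].
rewrite clW; split.
- by split=> //; apply: closed_ballxx.
- move=> B BW bB; apply: blam => //; exact: subset_trans sub.
- have /bounded_on_exP[M HM] := blam _ sub bW.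
  exists (- M) => _ [x Wx <-]; have := HM x Wx.
  by rewrite /= ler_norml => /andP[].
exists (fun s => c / K ^+ 2 * s ^+ 2).
  by apply: class_Kinfty_sqr; rewrite divr_gt0// exprn_gt0.
move=> p /inW[gp _] _; apply: le_trans gp.
rewrite -mulrA ler_pM2l// mulrC ler_pdivrMr ?exprn_gt0// -exprMn.
case: normN => N0 _ _ _.
rewrite ler_pXn2r// ?nnegrE ?mulr_ge0 ?(ltW K0)//.
apply: le_trans (NK _) _; rewrite mulrC ler_pM2r//.
by rewrite [leRHS]prod_normE le_max lexx.
Qed.

Lemma C2_on_differentiable (R : realType) (V : normedModType R) (A : set V)
    (g : V -> R) (p : V) :
  C2_on A g -> A p -> differentiable g p.
Proof. by move=> C2 /C2[[/nbhs_singleton]]. Qed.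

Lemma interior_state_set (R : realType) (n m : nat)
    (Y : set ('cV[R]_n * 'cV[R]_m)) (p : 'cV[R]_n * 'cV[R]_m) :
  interior Y p -> interior (state_set Y) p.1.
Proof.
move=> /nbhs_ballP[r /= r0 Hr]; apply/nbhs_ballP; exists r => //= x xr.
by exists p.2; apply: Hr; split=> //; exact: ballxx.
Qed.

Theorem theorem4p8 (R : realType) (n m : nat)
    (N : 'cV[R]_n -> R)
    (f : 'cV[R]_n * 'cV[R]_m -> 'cV[R]_n)
    (Y : set ('cV[R]_n * 'cV[R]_m))
    (l1 l2 : 'cV[R]_n * 'cV[R]_m -> R)
    (lam1 lam2 : 'cV[R]_n -> R)
    (e1 e2 : 'cV[R]_n * 'cV[R]_m)
    (e : R -> 'cV[R]_n * 'cV[R]_m)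
    (nu : R -> 'cV[R]_n) :
  is_norm N ->
  continuous f ->
  Y !=set0 ->
  strictly_dissipative Y f N l1 e1 lam1 ->
  strictly_dissipative Y f N l2 e2 lam2 ->
  C2_on (interior Y) l1 ->
  C2_on (interior Y) l2 ->
  C2_on (interior (state_set Y)) lam1 ->
  C2_on (interior (state_set Y)) lam2 ->
  let lamt mu := lambda_tilde mu lam1 lam2 (e mu).1 (nu mu) in
  let rc mu :=
    comb mu (rotated_cost f l1 e1 lam1) (rotated_cost f l2 e2 lam2) in
  (forall mu : R, 0 <= mu <= 1 ->
    [/\ optimal_equilibrium Y f (comb mu l1 l2) (e mu),
        interior Y (e mu),
        differentiable f (e mu) &
        lagrange_multiplier f (comb mu l1 l2) (e mu) (nu mu)]) ->
  (forall mu : R, 0 <= mu <= 1 ->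
    twice_differentiable (rc mu) (e mu) /\
    twice_differentiable (fun p => vdot (lamt mu) (f p)) (e mu)) ->
  (forall mu : R, 0 <= mu <= 1 ->
    exists m1 m2 : R, [/\ 0 <= m1, m1 < m2,
      loewner_le (m2%:M) (hess (rc mu) (e mu)) &
      loewner_le (hess (fun p => vdot (lamt mu) (f p)) (e mu)) (m1%:M)]) ->
  forall mu : R, 0 <= mu <= 1 ->
    locally_strictly_dissipative Y f N (comb mu l1 l2) (e mu)
      (fun x => comb mu lam1 lam2 x + vdot (lamt mu) x).
Proof.
move=> normN _ _ [_ blam1 _ _] [_ blam2 _ _] C2l1 C2l2 C2lam1 C2lam2 lamt rc.
move=> Hopt Hd2 Hhess mu mu01.
have [[[_ ee] _] Ye df kkt] := Hopt mu mu01.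
have [rc2 vf2] := Hd2 mu mu01.
have [m1 [m2 [_ m12 Hrc Hvf]]] := Hhess mu mu01.
set l := comb mu l1 l2 in kkt *; set lam := comb mu lam1 lam2.
have Xe := interior_state_set Ye.
have dlam1 := C2_on_differentiable C2lam1 Xe.
have dlam2 := C2_on_differentiable C2lam2 Xe.
have dlam : differentiable lam (e mu).1 by apply: differentiable_comb.
have dl : differentiable l (e mu).
  by apply: differentiable_comb;
    [apply: C2_on_differentiable C2l1 _|apply: C2_on_differentiable C2l2 _].
have lamtE : lamt mu = nu mu - grad lam (e mu).1.
  by rewrite /lamt /lambda_tilde grad_comb// opprD addrA.
pose const := rc mu (e mu).
(* The two rotated costs are normalised at [e1] and [e2], not at [e mu]; this
   only adds a constant. *)
have rcE p : rc mu p - const = rotated_cost f l (e mu) lam p.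
  rewrite /const /rc /l /lam /comb /rotated_cost -ee; ring.
have st h : 'D_h (rc mu) (e mu) + vdot (lamt mu) h.1
    - 'D_h (fun p => vdot (lamt mu) (f p)) (e mu) = 0.
  have -> : 'D_h (rc mu) (e mu) = 'D_h (rotated_cost f l (e mu) lam) (e mu).
    have -> : rotated_cost f l (e mu) lam = rc mu - cst const.
      by apply/funext => p; rewrite -rcE.
    have drc : differentiable (rc mu) (e mu) by apply: nbhs_singleton rc2.1.
    rewrite (deriveB (diff_derivable drc) (derivable_cst _ _ _)).
    by rewrite derive_cst subr0.
  by rewrite lamtE; apply: stationarity.
have c0 : 0 < (m2 - m1) / 4 by rewrite divr_gt0// subr_gt0.
apply: (dissipative_of_quadratic_growth normN Ye ee _ c0).
  move=> B BY bB.
  have /bounded_on_exP[M1 HM1] := blam1 B BY bB.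
  have /bounded_on_exP[M2 HM2] := blam2 B BY bB.
  have /bounded_on_exP[M HM] := bB.
  have [K K0 HK] := linear_lipschitz (@vdot_continuous R n (lamt mu)).
  apply/bounded_on_exP.
  exists (`|mu| * M1 + `|1 - mu| * M2 + K * M) => x Bx.
  apply: le_trans (ler_normD _ _) _; apply: lerD.
    apply: le_trans (ler_normD _ _) _; rewrite !normrM.
    by apply: lerD; rewrite ler_wpM2l// ?HM1 ?HM2.
  by apply: le_trans (HK x) _; rewrite ler_pM2l// HM.
have := quadratic_growth rc2 vf2 m12 Hrc Hvf st.
apply: filterS => h /le_trans; apply.
have vD (x y : 'cV[R]_n) : vdot (lamt mu) (x + y) =
  vdot (lamt mu) x + vdot (lamt mu) y by rewrite linearD.
rewrite -/const rcE /rotated_cost /lam -ee vD; lra.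
Qed.
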